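(* For $q$ with $0<|q|<1$ and $\zeta$ with $|q|<|\zeta|<1$, define $$\bar P_\omega(\zeta;q):=\frac{(q;q)_\infty}{(\zeta;q)_\infty(\zeta^{-1}q;q)_\infty(-q;q^2)_\infty}\sum_{n\ge1}\frac{(\zeta;q)_n(\zeta^{-1}q;q)_n(-q;q^2)_n}{(q;q)_{2n}}q^n.$$ Then $$\bar P_\omega(\zeta;q)=\frac{1}{(\zeta;q)_\infty(\zeta^{-1}q;q)_\infty(q;q)_\infty}\sum_{j\ge1}\sum_{n\ge0}\frac{(-1)^{j+1}i^n(1-\zeta^j)\big(1-(\zeta^{-1}q)^j\big)q^{\frac{j(j+1)}{2}+n(j+\frac12)}}{1+iq^{j+n+\frac12}}.$$
   Context: $(a;q)_n=\prod_{j=0}^{n-1}(1-aq^j)$ for $n\in\mathbb N_0\cup\{\infty\}$. Here $q=e^{2\pi i\tau}$ with $\tau\in\mathbb H$ and $q^{r}:=e^{2\pi i r\tau}$ for rational $r$. Note $\bar P_\omega(1;q)$ (taken as a limit $\zeta\to1$) equals the overpartition generating function $\bar P_\omega(q)=\sum_{n\ge1}\frac{(-q^{n+1};q)_n(-q^{2n+2};q^2)_\infty}{(1-q^n)(q^{n+1};q)_n(q^{2n+2};q^2)_\infty}q^n$. *)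

(* Defs.v *)
From Stdlib Require Import Reals.
Open Scope R_scope.

Definition CC : Type := (R * R)%type.

Definition RtoC (x : R) : CC := (x, 0).
Definition Czero : CC := (0, 0).
Definition Cone : CC := (1, 0).
Definition Ci : CC := (0, 1).
Definition Cadd (z w : CC) : CC := (fst z + fst w, snd z + snd w).
Definition Copp (z : CC) : CC := (- fst z, - snd z).
Definition Csub (z w : CC) : CC := Cadd z (Copp w).
Definition Cmul (z w : CC) : CC :=
  (fst z * fst w - snd z * snd w, fst z * snd w + snd z * fst w).
Definition Cinv (z : CC) : CC :=
  (fst z / (fst z ^ 2 + snd z ^ 2), - snd z / (fst z ^ 2 + snd z ^ 2)).
Definition Cdiv (z w : CC) : CC := Cmul z (Cinv w).
Definition Cmod (z : CC) : R := sqrt (fst z ^ 2 + snd z ^ 2).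
Fixpoint Cpow (z : CC) (n : nat) : CC :=
  match n with O => Cone | S m => Cmul z (Cpow z m) end.
Definition Cexp (z : CC) : CC := (exp (fst z) * cos (snd z), exp (fst z) * sin (snd z)).

Definition qpow (tau : CC) (r : R) : CC := Cexp (Cmul (RtoC (2 * PI * r)) (Cmul Ci tau)).

Fixpoint qpoch (a b : CC) (n : nat) : CC :=
  match n with
  | O => Cone
  | S m => Cmul (qpoch a b m) (Csub Cone (Cmul a (Cpow b m)))
  end.

Definition Ccv (u : nat -> CC) (l : CC) : Prop :=
  forall eps : R, eps > 0 -> exists N : nat, forall n : nat, (n >= N)%nat -> Cmod (Csub (u n) l) < eps.

Definition qpoch_inf (a b : CC) (l : CC) : Prop := Ccv (qpoch a b) l.

Fixpoint Cpsum (f : nat -> CC) (n : nat) : CC :=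
  match n with O => Czero | S m => Cadd (Cpsum f m) (f m) end.
Definition Cseries (f : nat -> CC) (l : CC) : Prop := Ccv (Cpsum f) l.

(* Main.v *)
(* Since (-q; q^2)_n = (i p; q)_n (-i p; q)_n with p = q^(1/2), the left side is a
   sum over n of a Bailey pair times a conjugate Bailey pair.  The finite Jacobi triple product, minus its
   instance at zeta = 1 where the product vanishes, writes
     (zeta)_n (q/zeta)_n / (q)_(2n)
       = sum_(r <= n) (-1)^(r+1) q^(r(r-1)/2) (1 - zeta^r) (1 - (q/zeta)^r) / ((q)_(n-r) (q)_(n+r)).
   After exchanging the sums over n and r, the inner sum over n is a 2phi1(a, b; ab; q, q)
   with a = -i p q^r and b = i p q^r, which Heine's transformation turns into the Lambert
   series sum_m b^m / (1 - a q^m). *)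
Require Import Defs.
From Stdlib Require Import Reals Lra Lia.
From Coquelicot Require Coquelicot.
Open Scope R_scope.

(** The theorem asserts that every product and series converges, as well as the identity, so
    convergence has to be proved throughout; every estimate is brought to a majorant B y^n, or B y^n
    y^m for double sums, with y < 1. The splitting of (-q; q^2)_n works because its two parameters
    have product q: shifted by q^r they have product q^(2r+1), which is exactly the base left in
    (q)_(n+r) once n starts at r. This is why the inner sum has lower parameter ab. The subtraction
    at zeta = 1 relies on zeta (q/zeta) = q: the difference of the two triple products then factors,
    and its term r = 0 disappears, which is where the range j >= 1 comes from. *)

Module QSeries.
Import Coquelicot.Coquelicot.
Open Scope C_scope.

(* [lim], [sum] and [qp] unfold to [Ccv], [Cpsum] and [qpoch] of Defs, but are
   stated with Coquelicot's operations so that [ring] and [field] apply. *)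
Definition lim (u : nat -> C) (l : C) : Prop :=
  forall eps : R, (eps > 0)%R ->
  exists N : nat, forall n : nat, (n >= N)%nat -> (Cmod (u n - l) < eps)%R.

Fixpoint sum (f : nat -> C) (n : nat) : C :=
  match n with O => 0 | S m => sum f m + f m end.

Definition series (f : nat -> C) (l : C) : Prop := lim (sum f) l.

(** * Limits of complex sequences *)

Lemma lim_ext u v l : (forall n, u n = v n) -> lim u l -> lim v l.
Proof.
  intros H Hu eps He. destruct (Hu eps He) as [N HN].
  exists N. intros n Hn. rewrite <- H. auto.
Qed.

Lemma lim_const c : lim (fun _ => c) c.
Proof.
  intros eps He. exists 0%nat. intros n _.
  replace (c - c) with (RtoC 0) by ring. rewrite Cmod_0. lra.
Qed.

Lemma lim_plus u v l m : lim u l -> lim v m -> lim (fun n => u n + v n) (l + m).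
Proof.
  intros Hu Hv eps He.
  destruct (Hu (eps / 2)%R) as [N HN]; [lra|].
  destruct (Hv (eps / 2)%R) as [M HM]; [lra|].
  exists (N + M)%nat. intros n Hn.
  replace (u n + v n - (l + m)) with ((u n - l) + (v n - m)) by ring.
  eapply Rle_lt_trans; [apply Cmod_triangle|].
  specialize (HN n ltac:(lia)). specialize (HM n ltac:(lia)). lra.
Qed.

Lemma lim_bounded u l : lim u l -> exists B, (0 < B)%R /\ forall n, (Cmod (u n) <= B)%R.
Proof.
  intros Hu. destruct (Hu 1%R) as [N HN]; [lra|].
  assert (H : forall M, exists B, (0 < B)%R /\ forall n, (n < M)%nat -> (Cmod (u n) <= B)%R).
  { induction M as [|M [B [HB IH]]].
    - exists 1%R. split; [lra|]. intros n Hn. lia.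
    - exists (B + Cmod (u M))%R. pose proof (Cmod_ge_0 (u M)). split; [lra|].
      intros n Hn. destruct (Nat.eq_dec n M) as [->|Hne]; [lra|].
      specialize (IH n ltac:(lia)). lra. }
  destruct (H N) as [B [HB HB']].
  exists (B + (1 + Cmod l))%R. pose proof (Cmod_ge_0 l). split; [lra|].
  intros n. destruct (Nat.lt_ge_cases n N) as [Hn|Hn].
  - specialize (HB' n Hn). lra.
  - specialize (HN n Hn). pose proof (Cmod_triangle (u n - l) l) as Ht.
    replace (u n - l + l) with (u n) in Ht by ring. lra.
Qed.

Lemma lim_mult u v l m : lim u l -> lim v m -> lim (fun n => u n * v n) (l * m).
Proof.
  intros Hu Hv. destruct (lim_bounded _ _ Hv) as [B [HB HBv]].
  intros eps He. pose proof (Cmod_ge_0 l) as Hl.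
  destruct (Hu (eps / 2 / B)%R) as [N HN]; [apply Rdiv_lt_0_compat; lra|].
  destruct (Hv (eps / 2 / (Cmod l + 1))%R) as [M HM]; [apply Rdiv_lt_0_compat; lra|].
  exists (N + M)%nat. intros n Hn.
  replace (u n * v n - l * m) with ((u n - l) * v n + l * (v n - m)) by ring.
  eapply Rle_lt_trans; [apply Cmod_triangle|]. rewrite !Cmod_mult.
  specialize (HN n ltac:(lia)). specialize (HM n ltac:(lia)). specialize (HBv n).
  assert (H1 : (Cmod (u n - l) * Cmod (v n) <= eps / 2)%R).
  { replace (eps / 2)%R with (eps / 2 / B * B)%R by (field; lra).
    apply Rmult_le_compat; try apply Cmod_ge_0; lra. }
  assert (H2 : (Cmod l * Cmod (v n - m) < eps / 2)%R).
  { replace (eps / 2)%R with ((Cmod l + 1) * (eps / 2 / (Cmod l + 1)))%R by (field; lra).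
    apply Rle_lt_trans with (Cmod l * (eps / 2 / (Cmod l + 1)))%R.
    - apply Rmult_le_compat_l; lra.
    - apply Rmult_lt_compat_r; [apply Rdiv_lt_0_compat; lra | lra]. }
  lra.
Qed.

Lemma lim_scal c u l : lim u l -> lim (fun n => c * u n) (c * l).
Proof. apply lim_mult, lim_const. Qed.

Lemma lim_shift k u l : lim u l -> lim (fun n => u (k + n)%nat) l.
Proof.
  intros Hu eps He. destruct (Hu eps He) as [N HN].
  exists N. intros n Hn. apply HN. lia.
Qed.

Lemma lim_unshift k u l : lim (fun n => u (k + n)%nat) l -> lim u l.
Proof.
  intros Hu eps He. destruct (Hu eps He) as [N HN].
  exists (k + N)%nat. intros n Hn. replace n with (k + (n - k))%nat by lia.
  apply HN. lia.
Qed.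

Lemma lim_Cmod_le u l B :
  lim u l -> (exists N, forall n, (n >= N)%nat -> (Cmod (u n) <= B)%R) -> (Cmod l <= B)%R.
Proof.
  intros Hu [N HN]. apply Rnot_lt_le. intros Hlt.
  destruct (Hu (Cmod l - B)%R) as [M HM]; [lra|].
  specialize (HM (N + M)%nat ltac:(lia)). specialize (HN (N + M)%nat ltac:(lia)).
  pose proof (Cmod_triangle (u (N + M)%nat) (- (u (N + M)%nat - l))) as Ht.
  rewrite Cmod_opp in Ht.
  replace (u (N + M)%nat + - (u (N + M)%nat - l)) with l in Ht by ring. lra.
Qed.

Lemma lim_unique u l m : lim u l -> lim u m -> l = m.
Proof.
  intros Hl Hm.
  assert (H : (Cmod (l - m) <= 0)%R).
  { apply lim_Cmod_le with (u := fun n => (-1) * u n + u n).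
    - replace (l - m) with (- ((-1) * l + m)) by ring.
      replace (- ((-1) * l + m)) with (l + (-1) * m) by ring.
      eapply lim_ext with (u := fun n => u n + (-1) * u n); [intros; ring|].
      apply lim_plus; [assumption|]. apply lim_scal; assumption.
    - exists 0%nat. intros n _. replace (-1 * u n + u n) with (RtoC 0) by ring.
      rewrite Cmod_0. lra. }
  pose proof (Cmod_ge_0 (l - m)) as H0.
  assert (H1 : l - m = 0) by (apply Cmod_eq_0; lra).
  replace l with (l - m + m) by ring. rewrite H1. ring.
Qed.

(** * Finite sums and series *)

Lemma sum_ext f g n : (forall k, (k < n)%nat -> f k = g k) -> sum f n = sum g n.
Proof.
  induction n as [|n IH]; intros H; [reflexivity|].
  simpl. rewrite IH, H by auto with arith. reflexivity.
Qed.

Lemma sum_plus f g n : sum (fun k => f k + g k) n = sum f n + sum g n.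
Proof. induction n as [|n IH]; simpl; [|rewrite IH]; ring. Qed.

Lemma sum_scal c f n : sum (fun k => c * f k) n = c * sum f n.
Proof. induction n as [|n IH]; simpl; [|rewrite IH]; ring. Qed.

Lemma sum_shift k f n : sum f (k + n) = sum f k + sum (fun m => f (k + m)%nat) n.
Proof.
  induction n as [|n IH].
  - rewrite Nat.add_0_r. simpl. ring.
  - rewrite Nat.add_succ_r. simpl. rewrite IH. ring.
Qed.

Lemma sum_exchange f n m :
  sum (fun i => sum (fun j => f i j) m) n = sum (fun j => sum (fun i => f i j) n) m.
Proof.
  induction n as [|n IH]; simpl.
  - induction m as [|m IHm]; simpl; [|rewrite <- IHm]; ring.
  - rewrite IH, <- sum_plus. reflexivity.
Qed.

Lemma Cmod_sum_geom f n B y :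
  (0 <= B)%R -> (0 <= y < 1)%R ->
  (forall k, (k < n)%nat -> (Cmod (f k) <= B * y ^ k)%R) ->
  (Cmod (sum f n) <= B / (1 - y))%R.
Proof.
  intros HB Hy H.
  (* The factor 1 - y^n, the exact value of the finite geometric sum, makes the induction close. *)
  assert (E : (Cmod (sum f n) <= B / (1 - y) * (1 - y ^ n))%R).
  { induction n as [|n IH].
    - simpl. rewrite Cmod_0. lra.
    - simpl. eapply Rle_trans; [apply Cmod_triangle|].
      replace (B / (1 - y) * (1 - y * y ^ n))%R
        with (B / (1 - y) * (1 - y ^ n) + B * y ^ n)%R by (field; lra).
      apply Rplus_le_compat; auto with arith. }
  eapply Rle_trans; [apply E|].
  assert (H0 : (0 <= B / (1 - y))%R) by (apply Rdiv_le_0_compat; lra).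
  pose proof (Rmult_le_pos _ _ H0 (pow_le y n (proj1 Hy))).
  lra.
Qed.

Lemma series_ext f g l : (forall n, f n = g n) -> series f l -> series g l.
Proof. intros H. apply lim_ext. intros n. apply sum_ext. auto. Qed.

Lemma series_scal c f l : series f l -> series (fun n => c * f n) (c * l).
Proof.
  intros H. eapply lim_ext; [|apply lim_scal, H]. intros n. symmetry. apply sum_scal.
Qed.

Lemma series_plus f g l m : series f l -> series g m -> series (fun n => f n + g n) (l + m).
Proof.
  intros Hf Hg. eapply lim_ext; [|apply lim_plus; [apply Hf|apply Hg]].
  intros n. symmetry. apply sum_plus.
Qed.

Lemma series_finite (f : nat -> C) n : (forall k, (n <= k)%nat -> f k = 0) -> series f (sum f n).
Proof.
  intros H. apply lim_unshift with n. eapply lim_ext; [|apply lim_const].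
  intros m. simpl. rewrite sum_shift.
  (* Zero is written as [0 * 0] so that [sum_scal] can pull out a factor 0. *)
  rewrite (sum_ext (fun m => f (n + m)%nat) (fun _ => 0 * 0)) by (intros; rewrite H by lia; ring).
  rewrite sum_scal. ring.
Qed.

Lemma series_shift k f l :
  series (fun n => f (k + n)%nat) l <-> series f (sum f k + l).
Proof.
  split; intros H.
  - apply lim_unshift with k.
    eapply lim_ext; [|apply lim_plus; [apply (lim_const (sum f k)) | apply H]].
    intros n. symmetry. apply sum_shift.
  - replace l with (- sum f k + (sum f k + l)) by ring.
    eapply lim_ext; [|apply lim_plus; [apply (lim_const (- sum f k)) | apply (lim_shift k), H]].
    intros n. simpl. rewrite sum_shift. ring.
Qed.

(** * Geometric majorants and interchange of summation *)

Lemma geom_small B y eps : (0 <= y < 1)%R -> (0 < eps)%R ->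
  exists N, forall n, (n >= N)%nat -> (Rabs (B * y ^ n) < eps)%R.
Proof.
  intros Hy He. pose proof (Rabs_pos B) as HB.
  destruct (pow_lt_1_zero y ltac:(rewrite Rabs_right; lra) (eps / (Rabs B + 1))%R) as [N HN].
  { apply Rdiv_lt_0_compat; lra. }
  exists N. intros n Hn. rewrite Rabs_mult. specialize (HN n Hn).
  apply Rle_lt_trans with ((Rabs B + 1) * Rabs (y ^ n))%R.
  - apply Rmult_le_compat_r; [apply Rabs_pos | lra].
  - replace eps with ((Rabs B + 1) * (eps / (Rabs B + 1)))%R by (field; lra).
    apply Rmult_lt_compat_l; lra.
Qed.

Lemma lim_of_geom u l B y : (0 <= y < 1)%R ->
  (forall n, (Cmod (u n - l) <= B * y ^ n)%R) -> lim u l.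
Proof.
  intros Hy H eps He. destruct (geom_small B y eps Hy He) as [N HN].
  exists N. intros n Hn. specialize (H n). specialize (HN n Hn).
  pose proof (Rle_abs (B * y ^ n)). lra.
Qed.

Lemma sum_diff_geom f B y n m :
  (0 <= B)%R -> (0 <= y < 1)%R -> (forall k, (Cmod (f k) <= B * y ^ k)%R) ->
  (n <= m)%nat -> (Cmod (sum f m - sum f n) <= B / (1 - y) * y ^ n)%R.
Proof.
  intros HB Hy H Hnm. replace m with (n + (m - n))%nat by lia. rewrite sum_shift.
  replace (sum f n + sum (fun k => f (n + k)%nat) (m - n) - sum f n)
    with (sum (fun k => f (n + k)%nat) (m - n)) by ring.
  replace (B / (1 - y) * y ^ n)%R with (B * y ^ n / (1 - y))%R by (field; lra).
  apply Cmod_sum_geom; trivial.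
  - apply Rmult_le_pos; [lra | apply pow_le; lra].
  - intros k _. eapply Rle_trans; [apply H|]. rewrite pow_add. lra.
Qed.

Lemma series_tail_geom f l B y n :
  (0 <= B)%R -> (0 <= y < 1)%R -> (forall k, (Cmod (f k) <= B * y ^ k)%R) ->
  series f l -> (Cmod (l - sum f n) <= B / (1 - y) * y ^ n)%R.
Proof.
  intros HB Hy H Hl.
  apply lim_Cmod_le with (u := fun m => sum f m + - sum f n).
  - apply lim_plus; [apply Hl | apply lim_const].
  - exists n. intros m Hm. apply (sum_diff_geom f B y n m); trivial.
Qed.

(** Completeness of the reals is applied to the real and imaginary parts separately ([p] below). The
    sum is returned in a sigma type because the inner Lambert sums have to form a function of their
    index, and that function is built from this witness. *)
Lemma ex_series_geom f B y :
  (0 <= y < 1)%R -> (forall k, (Cmod (f k) <= B * y ^ k)%R) -> { l | series f l }.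
Proof.
  intros Hy H.
  assert (HB : (0 <= B)%R).
  { pose proof (H 0%nat) as H0. pose proof (Cmod_ge_0 (f 0%nat)). simpl in H0. lra. }
  assert (HC : forall p : C -> R, (forall z, (Rabs (p z) <= Cmod z)%R) ->
     (forall z w, p (z - w) = (p z - p w)%R) -> { l : R | Un_cv (fun n => p (sum f n)) l }).
  { intros p Hp Hpm. apply Rcomplete.R_complete. intros eps He.
    destruct (geom_small (B / (1 - y)) y eps Hy He) as [N HN].
    assert (HW : forall n m, (n >= N)%nat -> (n <= m)%nat ->
       (R_dist (p (sum f n)) (p (sum f m)) < eps)%R).
    { intros n m Hn Hnm. unfold R_dist. rewrite Rabs_minus_sym, <- Hpm.
      eapply Rle_lt_trans; [apply Hp|].
      eapply Rle_lt_trans; [apply (sum_diff_geom f B y n m); assumption|].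
      eapply Rle_lt_trans; [apply Rle_abs|]. apply HN, Hn. }
    exists N. intros n m Hn Hm. destruct (Nat.le_ge_cases n m).
    - apply HW; assumption.
    - rewrite R_dist_sym. apply HW; assumption. }
  assert (HM : forall z : C, (Rabs (fst z) <= Cmod z /\ Rabs (snd z) <= Cmod z)%R).
  { intros z. pose proof (Rmax_Cmod z). pose proof (Rmax_l (Rabs (fst z)) (Rabs (snd z))).
    pose proof (Rmax_r (Rabs (fst z)) (Rabs (snd z))). lra. }
  destruct (HC fst) as [a Ha]; [apply HM | reflexivity |].
  destruct (HC snd) as [b Hb]; [apply HM | reflexivity |].
  exists (a, b). intros eps He.
  destruct (Ha (eps / 2)%R) as [N HN]; [lra|].
  destruct (Hb (eps / 2)%R) as [M HM']; [lra|].
  exists (N + M)%nat. intros n Hn.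
  specialize (HN n ltac:(lia)). specialize (HM' n ltac:(lia)).
  unfold R_dist in *.
  set (z := sum f n) in *.
  replace (z - (a, b)) with (RtoC (fst z - a) + Ci * RtoC (snd z - b)).
  - eapply Rle_lt_trans; [apply Cmod_triangle|].
    rewrite Cmod_mult, !Cmod_R, Cmod_Ci. lra.
  - destruct z as [z1 z2]. unfold RtoC, Ci, Cminus, Cplus, Cmult, Copp. simpl. f_equal; ring.
Qed.

(* Both iterated sums are limits of the square partial sums. *)
Lemma fubini_geom (f : nat -> nat -> C) (rows cols : nat -> C) (B y : R) (s : C) :
  (0 <= y < 1)%R ->
  (forall n m, (Cmod (f n m) <= B * y ^ n * y ^ m)%R) ->
  (forall n, series (f n) (rows n)) ->
  (forall m, series (fun n => f n m) (cols m)) ->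
  series rows s -> series cols s.
Proof.
  intros Hy Hf Hr Hc Hs.
  assert (HB : (0 <= B)%R).
  { pose proof (Hf 0%nat 0%nat) as H0. pose proof (Cmod_ge_0 (f 0%nat 0%nat)). simpl in H0. lra. }
  (* Each of the first N rows has a tail of size at most B y^n y^N / (1 - y); summing over n gives
     the second factor 1 / (1 - y). The claim is made for arbitrary [g] so that it also covers the
     transpose of [f]. *)
  assert (Hrow : forall g r, (forall n m, (Cmod (g n m) <= B * y ^ n * y ^ m)%R) ->
     (forall n, series (g n) (r n)) -> forall N,
     (Cmod (sum r N - sum (fun n => sum (g n) N) N) <= B / (1 - y) / (1 - y) * y ^ N)%R).
  { intros g r Hg Hgr N.
    replace (sum r N - sum (fun n => sum (g n) N) N)
      with (sum (fun n => r n + -1 * sum (g n) N) N)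
      by (rewrite sum_plus, sum_scal; ring).
    replace (B / (1 - y) / (1 - y) * y ^ N)%R
      with ((B / (1 - y) * y ^ N) / (1 - y))%R by (field; lra).
    apply Cmod_sum_geom; trivial.
    - apply Rmult_le_pos; [apply Rdiv_le_0_compat; lra | apply pow_le; lra].
    - intros n _. replace (r n + -1 * sum (g n) N) with (r n - sum (g n) N) by ring.
      replace (B / (1 - y) * y ^ N * y ^ n)%R with (B * y ^ n / (1 - y) * y ^ N)%R by (field; lra).
      apply series_tail_geom; trivial.
      + apply Rmult_le_pos; [lra | apply pow_le; lra]. }
  pose proof (Hrow f rows Hf Hr) as H1.
  assert (H2 := Hrow (fun m n => f n m) cols).
  specialize (H2 ltac:(intros n m; rewrite Rmult_assoc, (Rmult_comm (y ^ n)), <- Rmult_assoc; apply Hf) Hc).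
  set (K := (B / (1 - y) / (1 - y))%R) in *.
  unfold series in *. replace s with (s + 0) by ring.
  eapply lim_ext with (u := fun N => sum rows N + (sum cols N - sum rows N)); [intros; ring|].
  apply lim_plus; [assumption|].
  apply lim_of_geom with (B := (2 * K)%R) (y := y); trivial. intros N.
  specialize (H1 N). specialize (H2 N). simpl in H2. rewrite sum_exchange in H2.
  set (D := sum (fun j => sum (fun i => f j i) N) N) in *.
  change (sum (fun n => sum (f n) N) N) with D in H1.
  replace (sum cols N - sum rows N - 0) with ((sum cols N - D) + - (sum rows N - D)) by ring.
  eapply Rle_trans; [apply Cmod_triangle|]. rewrite Cmod_opp. lra.
Qed.

(** * Infinite products and q-Pochhammer symbols *)

Lemma one_minus_Cmod z : (Cmod z < 1)%R -> (1 - Cmod z <= Cmod (1 - z))%R /\ 1 - z <> 0.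
Proof.
  intros H.
  assert (H1 : (1 - Cmod z <= Cmod (1 - z))%R).
  { pose proof (Cmod_triangle (1 - z) z) as Ht.
    replace (1 - z + z) with (RtoC 1) in Ht by ring. rewrite Cmod_1 in Ht. lra. }
  split; [exact H1|]. apply Cmod_gt_0. lra.
Qed.

Lemma pow_le_1 x n : (0 <= x <= 1)%R -> (x ^ n <= 1)%R.
Proof. intros H. rewrite <- (pow1 n). apply pow_incr. lra. Qed.

Lemma Cmod_mul_pow_le a q n : (Cmod q < 1)%R -> (Cmod (a * q ^ n) <= Cmod a)%R.
Proof.
  intros H. rewrite Cmod_mult, Cmod_pow.
  pose proof (pow_le_1 (Cmod q) n ltac:(pose proof (Cmod_ge_0 q); lra)).
  pose proof (Cmod_ge_0 a). nra.
Qed.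

(** Stated through the deviations from 1 so that one convergence proof serves both (a;q)_n, with v_j
    = -a q^j, and its reciprocal, with v_j = a q^j / (1 - a q^j). *)
Fixpoint prod1p (v : nat -> C) (n : nat) : C :=
  match n with O => 1 | S m => prod1p v m * (1 + v m) end.

(** By 1 + x <= exp x the partial products are bounded by exp (K / (1 - y)). Successive differences
    [prod1p v n * v n] are then geometrically small, and the product is 1 plus their sum. *)
Lemma ex_lim_prod1p v K y :
  (0 <= y < 1)%R -> (forall j, (Cmod (v j) <= K * y ^ j)%R) -> exists l, lim (prod1p v) l.
Proof.
  intros Hy Hv.
  assert (HK : (0 <= K)%R).
  { pose proof (Hv 0%nat) as H0. pose proof (Cmod_ge_0 (v 0%nat)). simpl in H0. lra. }
  assert (HE : forall n, (Cmod (prod1p v n) <= exp (K / (1 - y) * (1 - y ^ n)))%R).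
  { induction n as [|n IH]; simpl.
    - rewrite Cmod_1, Rminus_diag, Rmult_0_r, exp_0. lra.
    - rewrite Cmod_mult.
      replace (K / (1 - y) * (1 - y * y ^ n))%R
        with (K / (1 - y) * (1 - y ^ n) + K * y ^ n)%R by (field; lra).
      rewrite exp_plus. apply Rmult_le_compat; try apply Cmod_ge_0; [exact IH|].
      eapply Rle_trans; [apply Cmod_triangle|]. rewrite Cmod_1.
      eapply Rle_trans; [|apply exp_ineq1_le]. specialize (Hv n). lra. }
  assert (HB : forall n, (Cmod (prod1p v n) <= exp (K / (1 - y)))%R).
  { intros n. eapply Rle_trans; [apply HE|].
    assert (H0 : (0 <= K / (1 - y))%R) by (apply Rdiv_le_0_compat; lra).
    pose proof (Rmult_le_pos _ _ H0 (pow_le y n (proj1 Hy))).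
    apply Rnot_lt_le. intros Hlt. apply exp_lt_inv in Hlt. lra. }
  destruct (ex_series_geom (fun n => prod1p v n * v n) (exp (K / (1 - y)) * K) y Hy) as [l Hl].
  { intros k. rewrite Cmod_mult, Rmult_assoc.
    apply Rmult_le_compat; try apply Cmod_ge_0; auto. }
  exists (1 + l). eapply lim_ext; [|apply lim_plus; [apply (lim_const 1) | apply Hl]].
  intros n. simpl. induction n as [|n IH]; simpl; [ring|]. rewrite <- IH. ring.
Qed.

Fixpoint qp (a q : C) (n : nat) : C :=
  match n with O => 1 | S m => qp a q m * (1 - a * q ^ m) end.

Lemma qp_factor_neq0 a q n : (Cmod a < 1)%R -> (Cmod q < 1)%R -> 1 - a * q ^ n <> 0.
Proof.
  intros Ha Hq. apply one_minus_Cmod. pose proof (Cmod_mul_pow_le a q n Hq). lra.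
Qed.

Lemma qp_neq0 a q n : (Cmod a < 1)%R -> (Cmod q < 1)%R -> qp a q n <> 0.
Proof.
  intros Ha Hq. induction n as [|n IH]; simpl.
  - apply Cmod_gt_0. rewrite Cmod_1. lra.
  - apply Cmult_neq_0; [exact IH | apply qp_factor_neq0; assumption].
Qed.

Lemma qp_add a q k n : qp a q (k + n) = qp a q k * qp (a * q ^ k) q n.
Proof.
  induction n as [|n IH].
  - rewrite Nat.add_0_r. simpl. ring.
  - rewrite Nat.add_succ_r. simpl. rewrite IH, Cpow_add_r. ring.
Qed.

(** Uses 1 / (1 - u) = 1 + u / (1 - u). Convergence of the reciprocals bounds the denominators
    uniformly and, since the two limits multiply to 1, shows that (a;q)_oo is nonzero. *)
Lemma lim_qp_inv a q : (Cmod a < 1)%R -> (Cmod q < 1)%R -> exists l, lim (fun n => / qp a q n) l.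
Proof.
  intros Ha Hq. pose proof (Cmod_ge_0 a). pose proof (Cmod_ge_0 q).
  destruct (ex_lim_prod1p (fun j => a * q ^ j / (1 - a * q ^ j)) (Cmod a / (1 - Cmod a)) (Cmod q))
    as [l Hl]; [lra| |].
  - intros j. pose proof (qp_factor_neq0 a q j Ha Hq) as Hne.
    pose proof (Cmod_mul_pow_le a q j Hq) as Hle.
    rewrite Cmod_div, Cmod_mult, Cmod_pow by assumption.
    destruct (one_minus_Cmod (a * q ^ j)) as [Hge _]; [lra|].
    replace (Cmod a / (1 - Cmod a) * Cmod q ^ j)%R
      with (Cmod a * Cmod q ^ j * / (1 - Cmod a))%R by (field; lra).
    apply Rmult_le_compat_l; [apply Rmult_le_pos; [lra | apply pow_le; lra]|].
    apply Rinv_le_contravar; lra.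
  - exists l. eapply lim_ext; [|apply Hl]. intros n.
    pose proof (fun n => qp_neq0 a q n Ha Hq) as H1.
    pose proof (fun n => qp_factor_neq0 a q n Ha Hq) as H2.
    induction n as [|n IH]; simpl.
    + field.
    + rewrite IH. field. auto.
Qed.

Lemma ex_lim_qp a q : (Cmod a < 1)%R -> (Cmod q < 1)%R -> exists l, lim (qp a q) l /\ l <> 0.
Proof.
  intros Ha Hq. pose proof (Cmod_ge_0 q).
  destruct (ex_lim_prod1p (fun j => - (a * q ^ j)) (Cmod a) (Cmod q)) as [l Hl]; [lra| |].
  { intros j. rewrite Cmod_opp, Cmod_mult, Cmod_pow. lra. }
  assert (Hl' : lim (qp a q) l).
  { eapply lim_ext; [|apply Hl]. intros n.
    induction n as [|n IH]; simpl; [|rewrite IH]; ring. }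
  exists l. split; [exact Hl'|]. destruct (lim_qp_inv a q Ha Hq) as [l' Hinv].
  assert (E : l * l' = 1).
  { eapply lim_unique; [apply lim_mult; [apply Hl' | apply Hinv]|].
    eapply lim_ext; [|apply lim_const]. intros n. simpl. field. apply qp_neq0; assumption. }
  intros ->. replace (0 * l') with (RtoC 0) in E by ring.
  apply (f_equal Cmod) in E. rewrite Cmod_0, Cmod_1 in E. lra.
Qed.

Lemma lim_qp_neq0 a q l : (Cmod a < 1)%R -> (Cmod q < 1)%R -> lim (qp a q) l -> l <> 0.
Proof.
  intros Ha Hq Hl. destruct (ex_lim_qp a q Ha Hq) as [l' [Hl' H0]].
  rewrite (lim_unique _ _ _ Hl Hl'). exact H0.
Qed.

Lemma lim_qp_tail a q l k : (Cmod a < 1)%R -> (Cmod q < 1)%R ->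
  lim (qp a q) l -> lim (qp (a * q ^ k) q) (l / qp a q k).
Proof.
  intros Ha Hq Hl. pose proof (qp_neq0 a q k Ha Hq) as Hne.
  replace (l / qp a q k) with (/ qp a q k * l) by (field; assumption).
  eapply lim_ext; [|apply lim_scal, (lim_shift k), Hl].
  intros n. simpl. rewrite qp_add. field. assumption.
Qed.

(** * The q-binomial theorem and Heine's transformation *)

Lemma qp_ratio_bounded a b q : (Cmod a < 1)%R -> (Cmod b < 1)%R -> (Cmod q < 1)%R ->
  exists B, (0 < B)%R /\ forall n, (Cmod (qp a q n / qp b q n) <= B)%R.
Proof.
  intros Ha Hb Hq. destruct (ex_lim_qp a q Ha Hq) as [l [Hl _]].
  destruct (lim_qp_inv b q Hb Hq) as [l' Hl'].
  exact (lim_bounded _ _ (lim_mult _ _ _ _ Hl Hl')).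
Qed.

(* F(z) = sum_n (a)_n/(q)_n z^n satisfies (1 - z) F(z) = (1 - a z) F(q z); iterate. *)
Lemma q_binomial_theorem a z q l1 l2 :
  (Cmod a < 1)%R -> (Cmod z < 1)%R -> (Cmod q < 1)%R ->
  lim (qp (a * z) q) l1 -> lim (qp z q) l2 ->
  series (fun n => qp a q n / qp q q n * z ^ n) (l1 / l2).
Proof.
  intros Ha Hz Hq H1 H2. pose proof (Cmod_ge_0 q) as Hq0.
  destruct (qp_ratio_bounded a q q Ha Hq Hq) as [B [HB HBc]].
  assert (Hqn : forall n, qp q q n <> 0) by (intros n; apply qp_neq0; assumption).
  assert (Hqf : forall n, 1 - q * q ^ n <> 0) by (intros n; apply qp_factor_neq0; assumption).
  set (c := fun n => qp a q n / qp q q n) in *.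
  assert (Hc0 : c 0%nat = 1) by (unfold c; simpl; field; apply (Hqn 0%nat)).
  (* This is (1 - q^(n+1)) c_(n+1) = (1 - a q^n) c_n, arranged so that multiplication by w^(n+1) and
     summation give the functional equation. *)
  assert (Hrec : forall n, c (S n) - c n = q ^ S n * c (S n) - a * q ^ n * c n).
  { intros n. unfold c. simpl. field. auto. }
  assert (Hbd : forall w k, (Cmod (c k * w ^ k) <= B * Cmod w ^ k)%R).
  { intros w k. rewrite Cmod_mult, Cmod_pow. apply Rmult_le_compat_r; [|apply HBc].
    apply pow_le, Cmod_ge_0. }
  assert (Hex : forall w, (Cmod w < 1)%R -> exists F, series (fun n => c n * w ^ n) F).
  { intros w Hw. pose proof (Cmod_ge_0 w).
    destruct (ex_series_geom _ B (Cmod w) ltac:(lra) (Hbd w)) as [F HF]. eauto. }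
  assert (Hfun : forall w F G, series (fun n => c n * w ^ n) F ->
     series (fun n => c n * (w * q) ^ n) G -> (1 - w) * F = (1 - a * w) * G).
  { intros w F G HF HG.
    assert (HF' : series (fun n => c (S n) * w ^ S n) (F - 1)).
    { apply (series_shift 1 (fun n => c n * w ^ n)). simpl. rewrite Hc0.
      replace (0 + 1 * 1 + (F - 1)) with F by ring. exact HF. }
    assert (HG' : series (fun n => c (S n) * (w * q) ^ S n) (G - 1)).
    { apply (series_shift 1 (fun n => c n * (w * q) ^ n)). simpl. rewrite Hc0.
      replace (0 + 1 * 1 + (G - 1)) with G by ring. exact HG. }
    assert (E : F - 1 + - w * F = G - 1 + - (a * w) * G).
    { eapply lim_unique.
      - apply (series_plus _ _ _ _ HF' (series_scal (- w) _ _ HF)).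
      - eapply series_ext; [|apply (series_plus _ _ _ _ HG' (series_scal (- (a * w)) _ _ HG))].
        intros n. simpl. rewrite !Cpow_mult_l. specialize (Hrec n). simpl in Hrec.
        replace (c (S n) * (w * q * (w ^ n * q ^ n)) + - (a * w) * (c n * (w ^ n * q ^ n)))
          with (w * w ^ n * (q * q ^ n * c (S n) - a * q ^ n * c n)) by ring.
        rewrite <- Hrec. ring. }
    replace ((1 - w) * F) with (F - 1 + - w * F + 1) by ring. rewrite E. ring. }
  destruct (Hex z Hz) as [F HF].
  assert (Hit : forall N, exists G, series (fun n => c n * (z * q ^ N) ^ n) G /\
     F * qp z q N = qp (a * z) q N * G).
  { induction N as [|N [G [HG E]]].
    - exists F. split; [|simpl; ring]. eapply series_ext; [|apply HF].
      intros n. simpl. rewrite Cmult_1_r. reflexivity.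
    - destruct (Hex (z * q ^ N * q)) as [G' HG'].
      { rewrite Cmod_mult. pose proof (Cmod_mul_pow_le z q N Hq). pose proof (Cmod_ge_0 (z * q ^ N)). nra. }
      exists G'. split.
      + replace (z * q ^ S N) with (z * q ^ N * q) by (simpl; ring). exact HG'.
      + pose proof (Hfun _ _ _ HG HG') as E'. simpl.
        replace (F * (qp z q N * (1 - z * q ^ N))) with (F * qp z q N * (1 - z * q ^ N)) by ring.
        rewrite E.
        replace (qp (a * z) q N * G * (1 - z * q ^ N)) with (qp (a * z) q N * ((1 - z * q ^ N) * G)) by ring.
        rewrite E'. ring. }
  destruct (lim_bounded _ _ H1) as [B1 [HB1 HBz]].
  (* The difference equals (az)_N (F(z q^N) - 1). Since c_0 = 1, the second factor is the tail of
     the series after its constant term, hence O(|q|^N). *)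
  assert (El : lim (fun N => F * qp z q N + -1 * qp (a * z) q N) 0).
  { apply lim_of_geom with (B := (B1 * (B / (1 - Cmod z)))%R) (y := Cmod q); [lra|].
    intros N. destruct (Hit N) as [G [HG E]]. rewrite E.
    replace (qp (a * z) q N * G + -1 * qp (a * z) q N - 0)
      with (qp (a * z) q N * (G - 1)) by ring.
    rewrite Cmod_mult, Rmult_assoc. apply Rmult_le_compat; try apply Cmod_ge_0; [apply HBz|].
    pose proof (Cmod_mul_pow_le z q N Hq) as Hle. pose proof (Cmod_ge_0 (z * q ^ N)) as Hge.
    pose proof (series_tail_geom _ _ B (Cmod (z * q ^ N)) 1 ltac:(lra) ltac:(lra) (Hbd _) HG) as Ht.
    simpl in Ht. rewrite Hc0, Rmult_1_r in Ht.
    replace (G - (0 + 1 * 1)) with (G - 1) in Ht by ring.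
    eapply Rle_trans; [apply Ht|]. rewrite Cmod_mult, Cmod_pow in *.
    pose proof (pow_le (Cmod q) N Hq0). pose proof (Cmod_ge_0 z).
    apply Rmult_le_compat; try lra.
    - apply Rdiv_le_0_compat; lra.
    - apply Rmult_le_compat_l; [lra|]. apply Rinv_le_contravar; lra.
    - nra. }
  pose proof (lim_unique _ _ _ El (lim_plus _ _ _ _ (lim_scal F _ _ H2) (lim_scal (-1) _ _ H1))) as E.
  pose proof (lim_qp_neq0 z q l2 Hz Hq H2) as Hne.
  replace (l1 / l2) with F; [exact HF|].
  replace F with ((F * l2 + -1 * l1 + l1) / l2) by (field; assumption).
  rewrite <- E. field. assumption.
Qed.

(* Heine's transformation of the balanced series, with argument q: both sides are
   iterated sums of (a)_n (a)_m q^n (b q^n)^m / ((q)_n (q)_m). *)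
Lemma heine_lambert a b q A B AB Q s :
  (Cmod a < 1)%R -> (Cmod b < 1)%R -> (Cmod q < 1)%R ->
  lim (qp a q) A -> lim (qp b q) B -> lim (qp (a * b) q) AB -> lim (qp q q) Q ->
  series (fun m => b ^ m / (1 - a * q ^ m)) s ->
  series (fun n => qp a q n * qp b q n / (qp q q n * qp (a * b) q n) * q ^ n)
    (A * B / (AB * Q) * s).
Proof.
  intros Ha Hb Hq HA HB HAB HQ Hs.
  pose proof (Cmod_ge_0 a) as Ha0. pose proof (Cmod_ge_0 b) as Hb0. pose proof (Cmod_ge_0 q) as Hq0.
  assert (Hab : (Cmod (a * b) < 1)%R) by (rewrite Cmod_mult; nra).
  destruct (qp_ratio_bounded a q q Ha Hq Hq) as [K [HK HKc]].
  pose proof (lim_qp_neq0 b q B Hb Hq HB) as NB.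
  pose proof (lim_qp_neq0 (a * b) q AB Hab Hq HAB) as NAB.
  pose proof (lim_qp_neq0 q q Q Hq Hq HQ) as NQ.
  assert (Nq : forall n, qp q q n <> 0) by (intros n; apply qp_neq0; assumption).
  assert (Na : forall n, qp a q n <> 0) by (intros n; apply qp_neq0; assumption).
  assert (Nb : forall n, qp b q n <> 0) by (intros n; apply qp_neq0; assumption).
  assert (Nab : forall n, qp (a * b) q n <> 0) by (intros n; apply qp_neq0; assumption).
  assert (Nf : forall n, 1 - a * q ^ n <> 0) by (intros n; apply qp_factor_neq0; assumption).
  (* For fixed m the sum over n has argument q^(m+1) and equals (a q^(m+1))_oo / (q^(m+1))_oo =
     (A/Q) (q)_m / (a)_(m+1); against (a)_m / (q)_m only 1 / (1 - a q^m) survives, which produces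
     the Lambert series. For fixed n the sum over m equals (ab q^n)_oo / (b q^n)_oo, which accounts
     for the factor AB/B. *)
  set (f := fun m n => qp a q m / qp q q m * b ^ m * (qp a q n / qp q q n * (q * q ^ m) ^ n)).
  assert (H : series (fun n => AB / B * (qp a q n * qp b q n / (qp q q n * qp (a * b) q n) * q ^ n))
                (A / Q * s)).
  { apply (fubini_geom f (fun m => A / Q * (b ^ m / (1 - a * q ^ m))) _ (K * K) (Rmax (Cmod b) (Cmod q))).
    - pose proof (Rmax_l (Cmod b) (Cmod q)). split; [lra | apply Rmax_lub_lt; assumption].
    - intros m n. unfold f. set (y := Rmax (Cmod b) (Cmod q)).
      replace (K * K * y ^ m * y ^ n)%R with (K * y ^ m * (K * y ^ n))%R by ring.
      assert (P : forall k w, (Cmod w <= y)%R ->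
                  (Cmod (qp a q k / qp q q k * w ^ k) <= K * y ^ k)%R).
      { intros k w Hw. rewrite Cmod_mult, Cmod_pow.
        apply Rmult_le_compat; try apply Cmod_ge_0; [apply pow_le, Cmod_ge_0 | apply HKc |].
        apply pow_incr. split; [apply Cmod_ge_0 | exact Hw]. }
      rewrite Cmod_mult. apply Rmult_le_compat; try apply Cmod_ge_0; apply P.
      + apply Rmax_l.
      + eapply Rle_trans; [apply Cmod_mul_pow_le, Hq | apply Rmax_r].
    - intros m.
      replace (A / Q * (b ^ m / (1 - a * q ^ m)))
        with (qp a q m / qp q q m * b ^ m * (A / qp a q (S m) / (Q / qp q q m)))
        by (simpl; field; auto).
      apply series_scal, q_binomial_theorem; trivial.
      + rewrite Cmult_comm. pose proof (Cmod_mul_pow_le q q m Hq). rewrite Cmult_comm. lra.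
      + pose proof (lim_qp_tail a q A (S m) Ha Hq HA) as Ht. exact Ht.
      + apply lim_qp_tail; assumption.
    - intros n.
      replace (AB / B * (qp a q n * qp b q n / (qp q q n * qp (a * b) q n) * q ^ n))
        with (qp a q n / qp q q n * q ^ n * ((AB / qp (a * b) q n) / (B / qp b q n)))
        by (field; auto 10).
      eapply series_ext with (f := fun m => qp a q n / qp q q n * q ^ n *
        (qp a q m / qp q q m * (b * q ^ n) ^ m)).
      + intros m. unfold f. rewrite !Cpow_mult_l, <- !Cpow_mult_r, (Nat.mul_comm m n). ring.
      + apply series_scal, q_binomial_theorem; trivial.
        * pose proof (Cmod_mul_pow_le b q n Hq). lra.
        * rewrite Cmult_assoc. apply lim_qp_tail; assumption.
        * apply lim_qp_tail; assumption.
    - apply series_scal, Hs. }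
  replace (A * B / (AB * Q) * s) with (B / AB * (A / Q * s)) by (field; auto).
  eapply series_ext; [|apply series_scal, H].
  intros n. simpl. field. auto 10.
Qed.

(** * The finite Jacobi triple product *)

(* tri q r = (-1)^r q^(r(r-1)/2) *)
Fixpoint tri (q : C) (r : nat) : C :=
  match r with O => 1 | S m => - q ^ m * tri q m end.

(** Pairs the terms r and -r of the bilateral sum of (-1)^r q^(r(r-1)/2) x^r: when x y = q,
    q^(r(r+1)/2) x^(-r) = q^(r(r-1)/2) y^r. The term r = 0 has no partner, hence 1 and not 2. *)
Definition jacobi_coef (x y q : C) (r : nat) : C :=
  match r with O => 1 | S _ => tri q r * (x ^ r + y ^ r) end.

(* Creative telescoping for the recurrence in n of the summand of [finite_jacobi],
   where (1 - q^(2n+1)) (1 - q^(2n+2)) = (q)_(2n+2) / (q)_(2n). *)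
Lemma finite_jacobi_telescope x y q n N :
  x * y = q -> (Cmod q < 1)%R -> (N <= n)%nat ->
  sum (fun r => jacobi_coef x y q r *
     ((1 - q * q ^ (2 * n)) * (1 - q * q ^ S (2 * n)) / (qp q q (S n - r) * qp q q (S n + r))
      - (1 - x * q ^ n) * (1 - y * q ^ n) / (qp q q (n - r) * qp q q (n + r)))) (S N)
  = q ^ n * tri q N / (qp q q (n - N) * qp q q (n + N)) *
    (x ^ S N + y ^ S N + q ^ S N * (x ^ N + y ^ N) * (1 - q ^ (n - N)) / (1 - q * q ^ (n + N))).
Proof.
  intros Hxy Hq. 
  assert (Nq : forall n, qp q q n <> 0) by (intros m; apply qp_neq0; assumption).
  assert (Nf : forall n, 1 - q * q ^ n <> 0) by (intros m; apply qp_factor_neq0; assumption).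
  induction N as [|N IH]; intros HN.
  - simpl sum. rewrite !Nat.sub_0_r, !Nat.add_0_r.
    replace (2 * n)%nat with (n + n)%nat by lia.
    pose proof (Nq n) as N1. pose proof (Nf n) as N2. simpl. rewrite !Cpow_add_r.
    generalize dependent (qp q q n). generalize dependent (q ^ n). intros Q N2 P N1.
    subst q. field. auto.
  - change (sum ?f (S (S N))) with (sum f (S N) + f (S N)). rewrite IH by lia. clear IH.
    (* Writing n = k + N + 1 removes truncated subtraction. With q^k, q^N, x^N, y^N and the
       Pochhammer symbols as indeterminates and q replaced by x y, the step is an identity of
       rational functions. *)
    destruct (Nat.le_exists_sub (S N) n HN) as [k [Hk _]].
    replace (n - N)%nat with (S k) by lia.
    replace (n - S N)%nat with k by lia.
    replace (S n - S N)%nat with (S k) by lia.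
    replace (S n + S N)%nat with (S (S (n + N)))%nat by lia.
    replace (n + S N)%nat with (S (n + N))%nat by lia.
    pose proof (Nq k) as N1. pose proof (Nq (n + N)%nat) as N2.
    pose proof (Nf k) as N3. pose proof (Nf (n + N)%nat) as N4.
    pose proof (Nf (S (n + N)%nat)) as N5.
    cbn [qp jacobi_coef tri].
    generalize dependent (qp q q k). generalize dependent (qp q q (n + N)%nat). intros P2 N2 P1 N1.
    replace (2 * n)%nat with (n + n)%nat by lia.
    cbn [Cpow] in *. rewrite !Cpow_add_r in *.
    assert (En : q ^ n = q * (q ^ k * q ^ N)).
    { subst n. rewrite Cpow_add_r. simpl. ring. }
    rewrite En in *. clear En Nq Nf Hk HN.
    generalize dependent (q ^ k). generalize dependent (q ^ N). intros Q u N3 N4 N5.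
    generalize (x ^ N) (y ^ N) (tri q N). intros X Y t.
    subst q. field. repeat split; assumption.
Qed.

(** Both sides, as sequences S_n, satisfy D S_(n+1) = W S_n. For the right side, telescoping covers
    r <= n; the remaining term r = n + 1, present only at level n + 1, cancels the telescoped value,
    in which the factor 1 - q^(n-N) vanishes at N = n. *)
Lemma finite_jacobi x y q n :
  x * y = q -> (Cmod q < 1)%R ->
  qp x q n * qp y q n / qp q q (2 * n) =
  sum (fun r => jacobi_coef x y q r / (qp q q (n - r) * qp q q (n + r))) (S n).
Proof.
  intros Hxy Hq.
  assert (Nq : forall n, qp q q n <> 0) by (intros m; apply qp_neq0; assumption).
  assert (Nf : forall n, 1 - q * q ^ n <> 0) by (intros m; apply qp_factor_neq0; assumption).
  induction n as [|n IH].
  - simpl. field.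
  - pose proof (finite_jacobi_telescope x y q n n Hxy Hq (Nat.le_refl n)) as T.
    set (D := (1 - q * q ^ (2 * n)) * (1 - q * q ^ S (2 * n))) in *.
    assert (HD : D <> 0) by (apply Cmult_neq_0; apply Nf).
    set (W := (1 - x * q ^ n) * (1 - y * q ^ n)) in *.
    assert (E : sum (fun r => jacobi_coef x y q r * (D / (qp q q (S n - r) * qp q q (S n + r))
         - W / (qp q q (n - r) * qp q q (n + r)))) (S n)
       = D * sum (fun r => jacobi_coef x y q r / (qp q q (S n - r) * qp q q (S n + r))) (S n)
         + - W * sum (fun r => jacobi_coef x y q r / (qp q q (n - r) * qp q q (n + r))) (S n)).
    { rewrite <- !sum_scal, <- sum_plus. apply sum_ext. intros r _. field. auto. }
    rewrite E, <- IH in T. clear E IH.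
    change (sum ?f (S (S n))) with (sum f (S n) + f (S n)). cbv beta.
    set (Z := sum _ (S n)) in *.
    replace Z with ((D * Z + - W * (qp x q n * qp y q n / qp q q (2 * n))
       + W * (qp x q n * qp y q n / qp q q (2 * n))) / D) by (field; auto).
    rewrite T. clear T Z.
    rewrite !Nat.sub_diag. replace (S n + S n)%nat with (S (S (2 * n))) by lia.
    replace (2 * S n)%nat with (S (S (2 * n))) by lia.
    replace (n + n)%nat with (2 * n)%nat by lia.
    pose proof (Nq (2 * n)%nat) as N1. pose proof (Nf (2 * n)%nat) as N2.
    pose proof (Nf (S (2 * n))%nat) as N3.
    unfold D, W in *. cbn [qp jacobi_coef tri].
    generalize dependent (qp q q (2 * n)). intros P N1.
    replace (2 * n)%nat with (n + n)%nat in * by lia.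
    cbn [Cpow] in *. rewrite !Cpow_add_r in *.
    field. repeat split; assumption.
Qed.

(** If x y = q then (1 - x^r)(1 - y^r) = (1 + q^r) - (x^r + y^r), so this is a difference of two
    values of [jacobi_coef]; it is 0 at r = 0. *)
Definition bailey_coef (x y q : C) (r : nat) : C := - tri q r * (1 - x ^ r) * (1 - y ^ r).

(* The difference of [finite_jacobi] at (x, y) and at (1, q), where the product vanishes. *)
Lemma finite_jacobi_sub x y q n :
  x * y = q -> (Cmod q < 1)%R ->
  qp x q (S n) * qp y q (S n) / qp q q (2 * S n) =
  sum (fun r => bailey_coef x y q r / (qp q q (S n - r) * qp q q (S n + r))) (S (S n)).
Proof.
  intros Hxy Hq.
  assert (Nq : forall n, qp q q n <> 0) by (intros m; apply qp_neq0; assumption).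
  (* The zero factor is the one with exponent 0. The empty product (1;q)_0 is 1, so the lemma is
     stated at [S n]. *)
  assert (H1 : qp 1 q (S n) = 0).
  { induction n as [|n IH]; [simpl; ring|].
    change (qp 1 q (S (S n))) with (qp 1 q (S n) * (1 - 1 * q ^ S n)). rewrite IH. ring. }
  pose proof (finite_jacobi x y q (S n) Hxy Hq) as E.
  pose proof (finite_jacobi 1 q q (S n) ltac:(ring) Hq) as E1.
  rewrite H1 in E1.
  transitivity (qp x q (S n) * qp y q (S n) / qp q q (2 * S n)
     + -1 * (0 * qp q q (S n) / qp q q (2 * S n))); [field; auto|].
  rewrite E, E1, <- sum_scal, <- sum_plus. apply sum_ext. intros r _.
  replace (bailey_coef x y q r) with (jacobi_coef x y q r - jacobi_coef 1 q q r); [field; auto|].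
  unfold bailey_coef. rewrite <- Hxy. destruct r as [|r].
  - simpl. ring.
  - unfold jacobi_coef. rewrite Cpow_1_l, Cpow_mult_l. ring.
Qed.

(** * Uniform bounds for the summands *)

Lemma qp_bounded a q : (Cmod a < 1)%R -> (Cmod q < 1)%R ->
  exists B, (0 < B)%R /\ forall n, (Cmod (qp a q n) <= B)%R.
Proof.
  intros Ha Hq. destruct (ex_lim_qp a q Ha Hq) as [l [Hl _]]. exact (lim_bounded _ _ Hl).
Qed.

Lemma qp_inv_bounded a q : (Cmod a < 1)%R -> (Cmod q < 1)%R ->
  exists B, (0 < B)%R /\ forall n, (Cmod (/ qp a q n) <= B)%R.
Proof.
  intros Ha Hq. destruct (lim_qp_inv a q Ha Hq) as [l Hl]. exact (lim_bounded _ _ Hl).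
Qed.

Lemma Cmod_mult_le u v A B :
  (Cmod u <= A)%R -> (Cmod v <= B)%R -> (Cmod (u * v) <= A * B)%R.
Proof.
  intros Hu Hv. rewrite Cmod_mult. apply Rmult_le_compat; try apply Cmod_ge_0; assumption.
Qed.

Lemma Cmod_one_minus_pow_le x r : (Cmod x < 1)%R -> (Cmod (1 - x ^ r) <= 2)%R.
Proof.
  intros Hx. eapply Rle_trans; [apply Cmod_triangle|].
  rewrite Cmod_opp, Cmod_1, Cmod_pow. pose proof (Cmod_ge_0 x).
  pose proof (pow_le_1 (Cmod x) r ltac:(lra)). lra.
Qed.

(** The factor 1 bounds [tri], a product of terms -q^m, and each 2 bounds one 1 - x^r or 1 - y^r;
    the product is left unevaluated to match [Cmod_mult_le]. *)
Lemma bailey_coef_bounded x y q r :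
  (Cmod x < 1)%R -> (Cmod y < 1)%R -> (Cmod q < 1)%R -> (Cmod (bailey_coef x y q r) <= 1 * 2 * 2)%R.
Proof.
  intros Hx Hy Hq. unfold bailey_coef.
  repeat apply Cmod_mult_le; try (apply Cmod_one_minus_pow_le; assumption).
  rewrite Cmod_opp. induction r as [|r IH]; simpl.
  - rewrite Cmod_1. lra.
  - replace 1%R with (1 * 1)%R by ring. apply Cmod_mult_le; [|exact IH].
    rewrite Cmod_opp, Cmod_pow. pose proof (Cmod_ge_0 q). apply pow_le_1. lra.
Qed.

Lemma ex_series_lambert b w q :
  (Cmod b < 1)%R -> (Cmod w < 1)%R -> (Cmod q < 1)%R ->
  { s | series (fun m => b ^ m / (1 - w * q ^ m)) s }.
Proof.
  intros Hb Hw Hq. pose proof (Cmod_ge_0 b).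
  apply (ex_series_geom _ (/ (1 - Cmod w)) (Cmod b)); [lra|].
  intros m. pose proof (Cmod_mul_pow_le w q m Hq) as Hle.
  destruct (one_minus_Cmod (w * q ^ m)) as [Hge Hne]; [lra|].
  rewrite Cmod_div, Cmod_pow by assumption. unfold Rdiv. rewrite Rmult_comm.
  apply Rmult_le_compat_r; [apply pow_le; lra|]. apply Rinv_le_contravar; lra.
Qed.

(** * The conjugate Bailey pair and Bailey's transform *)

(** With n = r + m, (a)_n = (a)_r (a q^r)_m and (q)_(n+r) = (q)_(2r) (q^(2r+1))_m, where q^(2r+1) =
    (a q^r)(b q^r). Hence [heine_lambert] applies at a q^r and b q^r, and the prefactors depending
    on r cancel against the tails of the infinite products, leaving q^r. *)
Lemma conjugate_bailey_pair a b q A B Q r s :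
  (Cmod a < 1)%R -> (Cmod b < 1)%R -> (Cmod q < 1)%R -> a * b = q ->
  lim (qp a q) A -> lim (qp b q) B -> lim (qp q q) Q ->
  series (fun m => (b * q ^ r) ^ m / (1 - a * q ^ r * q ^ m)) s ->
  series (fun m => qp a q (r + m) * qp b q (r + m) * q ^ (r + m) /
                   (qp q q m * qp q q (r + m + r))) (q ^ r * (A * B / (Q * Q)) * s).
Proof.
  intros Ha Hb Hq Hab HA HB HQ Hs.
  assert (Nq : forall n, qp q q n <> 0) by (intros n; apply qp_neq0; assumption).
  pose proof (qp_neq0 a q r Ha Hq) as Na. pose proof (qp_neq0 b q r Hb Hq) as Nb.
  pose proof (lim_qp_neq0 q q Q Hq Hq HQ) as NQ.
  pose proof (Cmod_mul_pow_le a q r Hq). pose proof (Cmod_mul_pow_le b q r Hq).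
  assert (Eab : a * q ^ r * (b * q ^ r) = q * q ^ (r + r)).
  { rewrite Cpow_add_r, <- Hab. ring. }
  assert (H1 : series (fun n => qp (a * q ^ r) q n * qp (b * q ^ r) q n /
       (qp q q n * qp (a * q ^ r * (b * q ^ r)) q n) * q ^ n)
       (A / qp a q r * (B / qp b q r) / (Q / qp q q (r + r) * Q) * s)).
  { apply heine_lambert; trivial; try lra; try (apply lim_qp_tail; assumption).
    rewrite Eab. apply lim_qp_tail; assumption. }
  replace (q ^ r * (A * B / (Q * Q)) * s)
    with (q ^ r * (qp a q r * qp b q r / qp q q (r + r)) *
      (A / qp a q r * (B / qp b q r) / (Q / qp q q (r + r) * Q) * s)) by (field; auto).
  eapply series_ext; [|apply series_scal, H1].
  intros m. simpl. rewrite Eab.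
  assert (E2 : qp q q (r + m + r) = qp q q (r + r) * qp (q * q ^ (r + r)) q m).
  { rewrite <- qp_add. f_equal. lia. }
  rewrite E2, (qp_add a), (qp_add b), (Cpow_add_r q r m).
  assert (N2 : qp (q * q ^ (r + r)) q m <> 0).
  { apply qp_neq0; [|assumption]. pose proof (Cmod_mul_pow_le q q (r + r) Hq). lra. }
  field. auto.
Qed.

(** Bailey's transform: with beta_n = sum_(r <= n) alpha_r / ((q)_(n-r) (q)_(n+r)) and gamma_r =
    sum_(n >= r) delta_n / ((q)_(n-r) (q)_(n+r)), the sums of beta_n delta_n and of alpha_r gamma_r
    agree. Here delta_n = (a)_n (b)_n q^n. *)
Lemma bailey_lambert a b x y q A B Q L inner :
  (Cmod x < 1)%R -> (Cmod y < 1)%R -> (Cmod a < 1)%R -> (Cmod b < 1)%R -> (Cmod q < 1)%R ->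
  x * y = q -> a * b = q ->
  lim (qp a q) A -> lim (qp b q) B -> lim (qp q q) Q ->
  (forall r, series (fun m => (b * q ^ r) ^ m / (1 - a * q ^ r * q ^ m)) (inner r)) ->
  series (fun k => qp x q (S k) * qp y q (S k) / qp q q (2 * S k) *
                   (qp a q (S k) * qp b q (S k) * q ^ S k)) L ->
  series (fun k => bailey_coef x y q (S k) * q ^ S k * inner (S k)) (Q * Q / (A * B) * L).
Proof.
  intros Hx Hy Ha Hb Hq Hxy Hab HA HB HQ Hin HL.
  (* The sum over r <= n has terms O(|q|^n), hence O(t^n t^r) for t = sqrt |q|. *)
  set (t := sqrt (Cmod q)).
  assert (Hp0 : (0 <= t)%R) by apply sqrt_pos.
  assert (Eq : Cmod q = (t * t)%R) by (symmetry; apply sqrt_sqrt, Cmod_ge_0).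
  assert (Hp : (t < 1)%R) by nra.
  assert (Nq : forall n, qp q q n <> 0) by (intros n; apply qp_neq0; assumption).
  pose proof (lim_qp_neq0 q q Q Hq Hq HQ) as NQ.
  pose proof (lim_qp_neq0 a q A Ha Hq HA) as NA.
  pose proof (lim_qp_neq0 b q B Hb Hq HB) as NB.
  destruct (qp_bounded a q Ha Hq) as [Ka [HKa Ba]].
  destruct (qp_bounded b q Hb Hq) as [Kb [HKb Bb]].
  destruct (qp_inv_bounded q q Hq Hq) as [K [HK BK]].
  set (al := bailey_coef x y q) in *.
  set (h := fun n r => qp a q n * qp b q n * q ^ n / (qp q q (n - r) * qp q q (n + r))).
  (* Extension by zero to r > n gives a full quadrant for [fubini_geom], and discards the entries
     where n - r would be truncated. *)
  set (f := fun n r => if (r <=? n)%nat then al r * h n r else 0).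
  assert (Hal0 : al 0%nat = 0) by (unfold al, bailey_coef; simpl; ring).
  assert (H : series (fun r => al r * (q ^ r * (A * B / (Q * Q)) * inner r)) L).
  { apply (fubini_geom f (fun n => sum (f n) (S n)) _ (1 * 2 * 2 * (Ka * Kb * (K * K))) t).
    - lra.
    - intros n r. unfold f. destruct (Nat.leb_spec r n) as [Hr|Hr].
      + replace (al r * h n r)
          with (al r * (qp a q n * qp b q n * (/ qp q q (n - r) * / qp q q (n + r))) * q ^ n)
          by (unfold h; field; auto).
        rewrite Rmult_assoc. apply Cmod_mult_le.
        * apply Cmod_mult_le; [apply bailey_coef_bounded; assumption|].
          repeat apply Cmod_mult_le; auto.
        * rewrite Cmod_pow, Eq, Rpow_mult_distr.
          apply Rmult_le_compat_l; [apply pow_le; lra|].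
          replace n with (r + (n - r))%nat by lia. rewrite pow_add.
          pose proof (pow_le_1 t (n - r) ltac:(lra)). pose proof (pow_le t r Hp0). nra.
      + rewrite Cmod_0. repeat apply Rmult_le_pos; try lra; apply pow_le; lra.
    - intros n. apply (series_finite (f n)). intros k Hk. unfold f.
      destruct (Nat.leb_spec k n); [lia | reflexivity].
    - intros r.
      replace (al r * (q ^ r * (A * B / (Q * Q)) * inner r))
        with (sum (fun n => f n r) r + al r * (q ^ r * (A * B / (Q * Q)) * inner r)).
      + apply series_shift. eapply series_ext; [|apply series_scal, (conjugate_bailey_pair a b q A B Q r (inner r)); auto].
        intros m. unfold f, h. destruct (Nat.leb_spec r (r + m)); [|lia].
        replace (r + m - r)%nat with m by lia. reflexivity.
      + rewrite (sum_ext (fun n => f n r) (fun _ => 0 * 0)).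
        * rewrite sum_scal. ring.
        * intros n Hn. unfold f. destruct (Nat.leb_spec r n); [lia | ring].
    (* Row 0 consists of the term r = 0 alone, which vanishes; from n = 1 on [finite_jacobi_sub]
       applies. *)
    - replace L with (sum (fun n => sum (f n) (S n)) 1 + L).
      + apply series_shift. eapply series_ext; [|apply HL]. intros n. cbv beta.
        rewrite finite_jacobi_sub by assumption.
        rewrite Cmult_comm, <- sum_scal. apply sum_ext. intros r Hr.
        unfold f, h. change (1 + n)%nat with (S n).
        destruct (Nat.leb_spec r (S n)); [|lia]. fold al. field. auto.
      + simpl. unfold f. simpl. rewrite Hal0. ring. }
  replace L with (sum (fun r => al r * (q ^ r * (A * B / (Q * Q)) * inner r)) 1 + L) in H
    by (simpl; rewrite Hal0; ring).
  apply series_shift in H.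
  eapply series_ext; [|apply series_scal, H]. intros k. simpl. field. auto.
Qed.

(** * Specialisation to the parameters -ip and ip *)

Lemma qp_neg_sq a b q n : a * b = q -> a + b = 0 ->
  qp (- q) (q ^ 2) n = qp a q n * qp b q n.
Proof.
  intros Hab H0. assert (Hb : b = - a) by (replace b with (a + b - a) by ring; rewrite H0; ring).
  induction n as [|n IH]; cbn [qp]; [ring|].
  rewrite IH. replace (q ^ 2) with (q * q) by ring. rewrite Cpow_mult_l.
  replace (- q * (q ^ n * q ^ n)) with (a * a * (q ^ n * q ^ n)) by (rewrite <- Hab, Hb; ring).
  rewrite Hb. ring.
Qed.

Lemma lambert_expansion p x y :
  (Cmod p < 1)%R -> (Cmod x < 1)%R -> (Cmod y < 1)%R -> x * y = p * p ->
  let q := p * p in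
  exists (Px Py Pq Pmq L s : C) (inner : nat -> C),
    lim (qp x q) Px /\ lim (qp y q) Py /\ lim (qp q q) Pq /\ lim (qp (- q) (q ^ 2)) Pmq /\
    series (fun k => qp x q (S k) * qp y q (S k) * qp (- q) (q ^ 2) (S k) / qp q q (2 * S k) * q ^ S k) L /\
    (forall k, series (fun m => bailey_coef x y q (S k) * q ^ S k *
        ((Ci * p * q ^ S k) ^ m / (1 + Ci * (p * q ^ (S k + m))))) (inner k)) /\
    series inner s /\
    Pq / (Px * Py * Pmq) * L = / (Px * Py * Pq) * s.
Proof.
  intros Hp Hx Hy Hxy q.
  pose proof (Cmod_ge_0 p).
  assert (Hq : (Cmod q < 1)%R) by (unfold q; rewrite Cmod_mult; nra).
  (* The order of the two roots matters: the Lambert terms b^m / (1 - a q^m) then carry i^m over 1 +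
     i p q^m; exchanging them would replace i by -i. *)
  set (b := Ci * p). set (a := - b).
  assert (Hb : (Cmod b < 1)%R) by (unfold b; rewrite Cmod_mult, Cmod_Ci; lra).
  assert (Ha : (Cmod a < 1)%R) by (unfold a; rewrite Cmod_opp; exact Hb).
  assert (Hab : a * b = q).
  { unfold a, b, q. replace (- (Ci * p) * (Ci * p)) with (- (Ci * Ci) * (p * p)) by ring.
    replace (Ci * Ci) with (RtoC (-1)); [ring|].
    unfold Ci, RtoC, Cmult. simpl. f_equal; ring. }
  assert (H0 : a + b = 0) by (unfold a; ring).
  assert (Nq : forall n, qp q q n <> 0) by (intros n; apply qp_neq0; assumption).
  destruct (ex_lim_qp x q Hx Hq) as [Px [HPx Nx]].
  destruct (ex_lim_qp y q Hy Hq) as [Py [HPy Ny]].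
  destruct (ex_lim_qp q q Hq Hq) as [Pq [HPq NPq]].
  destruct (ex_lim_qp a q Ha Hq) as [A [HA NA]].
  destruct (ex_lim_qp b q Hb Hq) as [B [HB NB]].
  assert (Hw : forall w r, (Cmod w < 1)%R -> (Cmod (w * q ^ r) < 1)%R).
  { intros w r Hw. pose proof (Cmod_mul_pow_le w q r Hq). lra. }
  set (lam := fun r => ex_series_lambert (b * q ^ r) (a * q ^ r) q (Hw b r Hb) (Hw a r Ha) Hq).
  destruct (qp_bounded x q Hx Hq) as [Kx [HKx Bx]].
  destruct (qp_bounded y q Hy Hq) as [Ky [HKy By]].
  destruct (qp_bounded a q Ha Hq) as [Ka [HKa Ba]].
  destruct (qp_bounded b q Hb Hq) as [Kb [HKb Bb]].
  destruct (qp_inv_bounded q q Hq Hq) as [K [HK BK]].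
  destruct (ex_series_geom (fun k => qp x q (S k) * qp y q (S k) / qp q q (2 * S k) *
     (qp a q (S k) * qp b q (S k) * q ^ S k)) (Kx * Ky * K * (Ka * Kb)) (Cmod q)) as [L HL].
  { pose proof (Cmod_ge_0 q). lra. }
  { intros k. rewrite Rmult_assoc. apply Cmod_mult_le.
    - repeat apply Cmod_mult_le; auto.
    - apply Cmod_mult_le; [apply Cmod_mult_le; auto|].
      change (q ^ S k) with (q * q ^ k). pose proof (Cmod_mult q (q ^ k)) as E.
      rewrite Cmod_pow in E. rewrite E. pose proof (pow_le (Cmod q) k (Cmod_ge_0 q)). nra. }
  (* [A * B] is (-q; q^2)_oo, the limit of (a)_n (b)_n. The outer sum is the value given by
     [bailey_lambert], so the closing equation is a cancellation of one Pq. *)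
  exists Px, Py, Pq, (A * B), L, (Pq * Pq / (A * B) * L),
    (fun k => bailey_coef x y q (S k) * q ^ S k * proj1_sig (lam (S k))).
  repeat split; try assumption.
  - eapply lim_ext; [|apply lim_mult; [apply HA | apply HB]].
    intros n. symmetry. apply qp_neg_sq; assumption.
  - eapply series_ext; [|apply HL]. intros k. cbv beta.
    rewrite (qp_neg_sq a b) by assumption. field. auto.
  - intros k. eapply series_ext; [|apply series_scal, (proj2_sig (lam (S k)))].
    intros m. cbv beta. do 2 f_equal. rewrite Cpow_add_r. unfold a, b. ring.
  - apply (bailey_lambert a b x y q A B Pq L (fun r => proj1_sig (lam r))); trivial.
    intros r. exact (proj2_sig (lam r)).
  - field. auto.
Qed.

(** * Fractional powers of q and the form of the final statement *)

(** Powers are defined through tau, so exponents add without any choice of branch; in particular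
    q^(1/2) squares to q. *)
Lemma qpow_plus tau r s : @eq C (qpow tau (r + s)) (qpow tau r * qpow tau s).
Proof.
  unfold qpow, Defs.Cexp, Defs.Cmul, Defs.RtoC, Defs.Ci, Cmult. simpl.
  set (u := (0 * fst tau - 1 * snd tau)%R). set (v := (0 * snd tau + 1 * fst tau)%R).
  replace (2 * PI * (r + s) * u - 0 * v)%R
    with ((2 * PI * r * u - 0 * v) + (2 * PI * s * u - 0 * v))%R by ring.
  replace (2 * PI * (r + s) * v + 0 * u)%R
    with ((2 * PI * r * v + 0 * u) + (2 * PI * s * v + 0 * u))%R by ring.
  generalize (2 * PI * r * u - 0 * v)%R (2 * PI * s * u - 0 * v)%R
    (2 * PI * r * v + 0 * u)%R (2 * PI * s * v + 0 * u)%R. intros r1 s1 r2 s2.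
  rewrite exp_plus, cos_plus, sin_plus. f_equal; ring.
Qed.

Lemma qpow_INR_mult tau n r : @eq C (qpow tau (INR n * r)) (qpow tau r ^ n).
Proof.
  induction n as [|n IH].
  - unfold qpow, Defs.Cexp, Defs.Cmul, Defs.RtoC. simpl.
    rewrite !Rmult_0_l, Rmult_0_r, !Rmult_0_l, Rminus_0_r, Rplus_0_r, exp_0, cos_0, sin_0.
    unfold RtoC. f_equal; ring.
  - rewrite S_INR, Rmult_plus_distr_r, Rmult_1_l, qpow_plus, IH. simpl. ring.
Qed.

(** The exponents combine as j(j-1)/2 + j = j(j+1)/2; induction on j avoids halving natural
    numbers. *)
Lemma tri_qpow tau j :
  tri (qpow tau 1) j * qpow tau 1 ^ j = RtoC ((-1) ^ j) * qpow tau (INR j * (INR j + 1) / 2).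
Proof.
  induction j as [|j IH].
  - replace (INR 0 * (INR 0 + 1) / 2)%R with (INR 0 * 1)%R by (simpl; field).
    rewrite qpow_INR_mult. reflexivity.
  - replace (INR (S j) * (INR (S j) + 1) / 2)%R
      with (INR j * (INR j + 1) / 2 + INR (S j) * 1)%R by (rewrite S_INR; field).
    rewrite qpow_plus, qpow_INR_mult.
    replace (RtoC ((-1) ^ S j)) with (- RtoC ((-1) ^ j)) by (rewrite <- RtoC_opp; f_equal; simpl; ring).
    transitivity (- (tri (qpow tau 1) j * qpow tau 1 ^ j) * qpow tau 1 ^ S j); [simpl; ring|].
    rewrite IH. ring.
Qed.

(** The sign in [bailey_coef] turns (-1)^j into (-1)^(j+1), and (q^(1/2) q^j)^n supplies the
    exponent n(j + 1/2). *)
Lemma lambert_summand_qpow tau x y j n :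
  bailey_coef x y (qpow tau 1) j * qpow tau 1 ^ j *
    ((Ci * qpow tau (1 / 2) * qpow tau 1 ^ j) ^ n / (1 + Ci * (qpow tau (1 / 2) * qpow tau 1 ^ (j + n)))) =
  RtoC ((-1) ^ (j + 1)) * Ci ^ n * (1 - x ^ j) * (1 - y ^ j) *
    qpow tau (INR j * (INR j + 1) / 2 + INR n * (INR j + 1 / 2)) /
    (1 + Ci * qpow tau (INR j + INR n + 1 / 2)).
Proof.
  replace (INR j + INR n + 1 / 2)%R with (1 / 2 + INR (j + n) * 1)%R by (rewrite plus_INR; ring).
  replace (INR j + 1 / 2)%R with (1 / 2 + INR j * 1)%R by ring.
  rewrite !qpow_plus, !qpow_INR_mult, qpow_plus, qpow_INR_mult, pow_add.
  replace (RtoC ((-1) ^ j * (-1) ^ 1)) with (- RtoC ((-1) ^ j))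
    by (rewrite <- RtoC_opp; f_equal; simpl; ring).
  unfold Cdiv. rewrite Cmult_assoc. f_equal.
  transitivity (- (tri (qpow tau 1) j * qpow tau 1 ^ j) * (1 - x ^ j) * (1 - y ^ j) *
    (Ci * qpow tau (1 / 2) * qpow tau 1 ^ j) ^ n); [unfold bailey_coef; ring|].
  rewrite tri_qpow, !Cpow_mult_l. ring.
Qed.

(** The role of the annulus |q| < |zeta|: it makes zeta nonzero and puts q/zeta inside the unit
    disc, as needed for the second parameter y. *)
Lemma Cmod_quotient_lt_1 q z : (Cmod q < Cmod z)%R -> (Cmod (/ z * q) < 1)%R /\ z * (/ z * q) = q.
Proof.
  intros H. pose proof (Cmod_ge_0 q).
  assert (Hz : z <> 0) by (apply Cmod_gt_0; lra).
  split; [|field; exact Hz].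
  rewrite Cmod_mult, Cmod_inv by exact Hz. apply Rmult_lt_reg_l with (Cmod z); [lra|].
  replace (Cmod z * (/ Cmod z * Cmod q))%R with (Cmod q) by (field; lra). lra.
Qed.

Lemma theorem3p1_Coquelicot tau zeta :
  (Cmod (qpow tau 1) < Cmod zeta)%R -> (Cmod zeta < 1)%R ->
  let q : C := qpow tau 1 in
  let zq := / zeta * q in
  exists (Pz Pzq Pq Pmq L s : C) (inner : nat -> C),
    lim (qp zeta q) Pz /\ lim (qp zq q) Pzq /\ lim (qp q q) Pq /\ lim (qp (- q) (q ^ 2)) Pmq /\
    series (fun k => qp zeta q (S k) * qp zq q (S k) * qp (- q) (q ^ 2) (S k) / qp q q (2 * S k) * q ^ S k) L /\
    (forall k, series (fun n => RtoC ((-1) ^ (S k + 1)) * Ci ^ n * (1 - zeta ^ S k) * (1 - zq ^ S k) *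
       qpow tau (INR (S k) * (INR (S k) + 1) / 2 + INR n * (INR (S k) + 1 / 2)) /
       (1 + Ci * qpow tau (INR (S k) + INR n + 1 / 2))) (inner k)) /\
    series inner s /\
    Pq / (Pz * Pzq * Pmq) * L = / (Pz * Pzq * Pq) * s.
Proof.
  intros H1 H2 q zq.
  set (p := qpow tau (1 / 2) : C).
  assert (Eq : q = p * p).
  { unfold q, p. rewrite <- qpow_plus. f_equal. field. }
  destruct (Cmod_quotient_lt_1 q zeta H1) as [Hzq Exy].
  assert (Hp : (Cmod p < 1)%R).
  { pose proof (Cmod_mult p p) as E. rewrite <- Eq in E.
    assert (Hq : (Cmod q < 1)%R) by (eapply Rlt_trans; eassumption).
    pose proof (Cmod_ge_0 p). nra. }
  destruct (lambert_expansion p zeta zq Hp H2 Hzq) as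
    (Pz & Pzq & Pq & Pmq & L & s & inner & HPz & HPzq & HPq & HPmq & HL & Hin & Hs & E);
    [rewrite <- Eq; exact Exy|].
  rewrite <- Eq in *.
  exists Pz, Pzq, Pq, Pmq, L, s, inner. repeat split; try assumption.
  intros k. eapply series_ext; [|apply (Hin k)].
  intros n. apply lambert_summand_qpow.
Qed.

(* Rewriting with these, rather than converting whole formulas, keeps the
   comparison from unfolding nested complex products into their components. *)
Lemma Defs_operations :
  (Defs.Cadd = Cplus /\ Defs.Csub = Cminus /\ Defs.Cmul = Cmult /\ Defs.Copp = Copp /\
   Defs.Cinv = Cinv /\ Defs.Cdiv = Cdiv /\ Defs.Cpow = Cpow /\ Defs.Cmod = Cmod) /\
  (Defs.Cone = RtoC 1 /\ Defs.Ci = Ci /\ Defs.RtoC = RtoC) /\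
  (qpoch = qp /\ Ccv = lim /\ Cseries = series).
Proof. repeat split; reflexivity. Qed.

End QSeries.

Theorem theorem3p1 (tau zeta : CC) :
  0 < snd tau ->
  Cmod (qpow tau 1) < Cmod zeta -> Cmod zeta < 1 ->
  let q := qpow tau 1 in
  let zq := Cmul (Cinv zeta) q in
  exists (Pz Pzq Pq Pmq L Rs : CC) (inner : nat -> CC),
    qpoch_inf zeta q Pz /\
    qpoch_inf zq q Pzq /\
    qpoch_inf q q Pq /\
    qpoch_inf (Copp q) (Cpow q 2) Pmq /\
    (* L = sum_{n>=1} (zeta;q)_n (zeta^-1 q;q)_n (-q;q^2)_n / (q;q)_{2n} q^n *)
    Cseries (fun k => let n := S k in
       Cmul (Cdiv (Cmul (Cmul (qpoch zeta q n) (qpoch zq q n)) (qpoch (Copp q) (Cpow q 2) n))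
                  (qpoch q q (2 * n)))
            (Cpow q n)) L /\
    (* inner j = sum_{n>=0} of the summand with index j+1 *)
    (forall k : nat, let j := S k in
       Cseries (fun n =>
         Cdiv
           (Cmul (Cmul (Cmul (Cmul (RtoC ((-1) ^ (j + 1))) (Cpow Ci n))
                             (Csub Cone (Cpow zeta j)))
                       (Csub Cone (Cpow zq j)))
                 (qpow tau (INR j * (INR j + 1) / 2 + INR n * (INR j + 1 / 2))))
           (Cadd Cone (Cmul Ci (qpow tau (INR j + INR n + 1 / 2)))))
         (inner k)) /\
    Cseries inner Rs /\
    Cmul (Cdiv Pq (Cmul (Cmul Pz Pzq) Pmq)) L =
    Cmul (Cinv (Cmul (Cmul Pz Pzq) Pq)) Rs.
Proof.
  destruct QSeries.Defs_operations as
    [[-> [-> [-> [-> [-> [-> [-> ->]]]]]]] [[-> [-> ->]] [Eqp [Ecv Eseries]]]].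
  unfold qpoch_inf. rewrite Eqp, Ecv, Eseries.
  intros _ H1 H2. exact (QSeries.theorem3p1_Coquelicot tau zeta H1 H2).
Qed.
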